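(* Let $\Lambda$ be a Lagrangian as in the context. Assume that $\Lambda$ is radially convex in the control variable, as in (A$_c$). Assume moreover that: (a) $\Lambda$ is bounded on the bounded sets that are well-inside $\mathrm{Dom}(\Lambda)$; (b) for all $K\ge0$ there is $r_K>0$ such that $(s,y,u)\in\mathrm{Dom}(\Lambda)$ whenever $s\in[0,T]$, $y\in\mathbb R^n$ with $|y|\le K$, and $u\in\mathbb R^m$ with $|u|\le r_K$. Then $\Lambda$ satisfies the growth condition (M$_B^\delta$) for any choice of $B\ge0$ and $\delta\in[0,T[$. In particular, the condition is satisfied whenever $\Lambda$ is real valued, continuous and radially convex in the control variable.
   Context: $T>0$, $n,m\ge1$; $\mathcal U\subseteq\mathbb R^m$ is a nonempty cone ($u\in\mathcal U,\lambda>0\Rightarrow\lambda u\in\mathcal U$). $\Lambda:[0,T]\times\mathbb R^n\times\mathbb R^m\to[0,+\infty]$ is Lebesgue–Borel measurable (w.r.t. the $\sigma$-algebra generated by products of Lebesgue measurable subsets of $[0,T]$ and Borel subsets of $\mathbb R^n\times\mathbb R^m$), and there are fixed $\alpha>0$, $d\ge0$ with $\Lambda(s,y,u)\ge\alpha|u|-d$ for a.e. $s\in[0,T]$ and all $y\in\mathbb R^n,u\in\mathcal U$. $\mathrm{Dom}(\Lambda):=\{(s,y,u):\Lambda(s,y,u)<+\infty\}$; for a.e. $s$ and every $y$: $\Lambda(s,y,u)<+\infty$, $0<r\le1$ imply $\Lambda(s,y,ru)<+\infty$. $\partial\mathrm{Dom}(\Lambda)$ is the boundary in $[0,T]\times\mathbb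 R^n\times\mathbb R^m$ and $\mathrm{dist}$ the Euclidean distance (if $\Lambda$ is real valued, the requirement $\mathrm{dist}(\cdot,\partial\mathrm{Dom}(\Lambda))\ge\rho$ is trivially fulfilled). A subset of $\mathrm{Dom}(\Lambda)$ is *well-inside* $\mathrm{Dom}(\Lambda)$ if for some $\rho>0$ all its points satisfy $\mathrm{dist}(\cdot,\partial\mathrm{Dom}(\Lambda))\ge\rho$. **(A$_c$)** (radial convexity in the control): for a.e. $s\in[0,T]$ and all $y\in\mathbb R^n$, $u\in\mathcal U$, the map $0<r\mapsto\Lambda(s,y,ru)$ is convex. **(A$_d$)** (partial differentiability): for a.e. $s\in[0,T]$ and all $y\in\mathbb R^n$, the derivative $D_u\Lambda(s,y,u):=\lim_{h\to0}\frac{\Lambda(s,y,u+hu)-\Lambda(s,y,u)}h$ exists at every $u\in\mathcal U$ with $(s,y,u)\in\mathrm{Dom}(\Lambda)$. **Constant.** $c_t(B):=\frac{B+d(T-t)}{\alpha(T-t)}$. **Subdifferential.** For $(s,y,u)\in\mathrm{Dom}(\Lambda)$, $\partial_r\Lambda(s,y,ru)_{r=1}:=\{q\in\mathbb R:\ \Lambda(s,y,ru)-\Lambda(s,y,u)\ge q(r-1)\ \forall r>0\}$. A selection $Q$ of it is a function with $Q(s,y,u)\in\partial_r\Lambda(s,y,ru)_{r=1}$ for $(s,y,u)\in\mathrm{Dom}(\Lambda)$. Conventions: $\sup\emptyset=-\infty$, $\inf\emptyset=+\infty$. For $K\ge0$, $\nu,c,\rho>0$ set $E_{K,\nu}:=\{(s,y,u)\in\mathrm{Dom}(\Lambda):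 |y|\le K,\ u\in\mathcal U,\ |u|\ge\nu\}$, $F_{K,c,\rho}:=\{(s,y,u)\in\mathrm{Dom}(\Lambda): |y|\le K,\ u\in\mathcal U,\ |u|<c,\ \mathrm{dist}((s,y,u),\partial\mathrm{Dom}(\Lambda))\ge\rho\}$. **Growth condition (M$_B^\delta$)** ($0\le\delta<T$, $B\ge0$). For all $K\ge0$ there are $\overline\nu>0$ and $c>c_\delta(B)$ such that: either (A$_c$) holds and there is a selection $Q$ of $\partial_r\Lambda(s,y,ru)_{r=1}$, or (A$_d$) holds and $Q:=D_u\Lambda$, satisfying, for all $\rho>0$, $$-\infty<\inf_{F_{K,c,\rho}}\{\Lambda-Q\}\quad\text{and}\quad\sup_{E_{K,\overline\nu}}\{\Lambda-Q\}<+\infty.$$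
   Formalization: A selection Q (and Q := D_uΛ) is required to lie in the subdifferential (equal the derivative) only at points of Dom(Λ) where it is nonempty (exists); literally the claim fails, e.g. for Λ = 1 − √(1−|u|²) on |u| ≤ 1, +∞ elsewhere, with empty subdifferential at |u| = 1. *)

(* Defs.v *)
From HB Require Import structures.
From mathcomp Require Import all_boot all_order all_algebra.
From mathcomp Require Import all_classical all_reals all_analysis.
From mathcomp Require Import measurable_realfun.

Set Implicit Arguments.
Unset Strict Implicit.
Unset Printing Implicit Defensive.

Import Order.TTheory GRing.Theory Num.Theory.
Import numFieldNormedType.Exports.

Local Open Scope classical_set_scope.
Local Open Scope ring_scope.

(* The point (s, y, u) of R x R^n x R^m is encoded as (s, (y, u)). *)
Notation spoint R n m := (R * ('rV[R]_n * 'rV[R]_m))%type (only parsing).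

(* The library norm on 'rV[R]_k is the sup norm, so the Euclidean one is
   defined here; both induce the same topology. *)
Definition enorm (R : realType) (k : nat) (x : 'rV[R]_k) : R :=
  Num.sqrt (\sum_(i < k) x ord0 i ^+ 2).

Definition edist (R : realType) (n m : nat) (p q : spoint R n m) : R :=
  Num.sqrt ((p.1 - q.1) ^+ 2 + enorm (p.2.1 - q.2.1) ^+ 2
            + enorm (p.2.2 - q.2.2) ^+ 2).

(* The value is +oo when A is empty. *)
Definition dist_to (R : realType) (n m : nat) (p : spoint R n m)
    (A : set (spoint R n m)) : \bar R :=
  ereal_inf [set (edist p q)%:E | q in A].

Definition cone (R : realType) (m : nat) (U : set 'rV[R]_m) : Prop :=
  forall u (l : R), U u -> 0 < l -> U (l *: u).

Section Lagrangian.
Context (R : realType) (n m : nat).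
Implicit Types (T alpha d t B K nu c rho : R) (U : set 'rV[R]_m).
Implicit Types (L : spoint R n m -> \bar R) (Q : spoint R n m -> R).

(* [0, T] x R^n x R^m; the values of L outside this set are irrelevant. *)
Definition domain T : set (spoint R n m) := [set p | 0 <= p.1 <= T].

Definition Dom T L : set (spoint R n m) :=
  [set p | domain T p /\ (L p < +oo)%E].

(* Boundary relative to the subspace [0, T] x R^n x R^m. *)
Definition boundary_Dom T L : set (spoint R n m) :=
  domain T `&` closure (Dom T L) `&` closure (domain T `\` Dom T L).

Definition well_inside T L (S : set (spoint R n m)) : Prop :=
  S `<=` Dom T L /\
  exists2 rho, 0 < rho &
    forall p, S p -> (rho%:E <= dist_to p (boundary_Dom T L))%E.

Definition ae_time T (P : R -> Prop) : Prop :=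
  {ae (@lebesgue_measure R), forall s, 0 <= s <= T -> P s}.

(* The library type R carries the Borel sigma-algebra; Lebesgue measurable sets
   are the Caratheodory measurable ones, see completed_caratheodory_measurable. *)
Definition lebesgue_measurable (A : set R) : Prop :=
  ((@wlength R idfun)^*%mu).-cara.-measurable A.

Definition borel_measurable (C : set ('rV[R]_n * 'rV[R]_m)) : Prop :=
  <<s [set O : set ('rV[R]_n * 'rV[R]_m) | open O] >> C.

Definition lebesgue_borel T : set (set (spoint R n m)) :=
  <<s domain T,
      [set X | exists A C, [/\ lebesgue_measurable A, A `<=` `[0, T],
                               borel_measurable C & X = A `*` C]] >>.

Definition lebesgue_borel_measurable_fun T L : Prop :=
  forall B : set (\bar R), measurable B ->
    lebesgue_borel T (domain T `&` L @^-1` B).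

Record is_lagrangian T U alpha d L : Prop := IsLagrangian {
  lagrangian_ge0 : forall p, domain T p -> (0 <= L p)%E ;
  lagrangian_measurable : lebesgue_borel_measurable_fun T L ;
  lagrangian_growth : ae_time T (fun s => forall y u, U u ->
    ((alpha * enorm u - d)%:E <= L (s, (y, u)))%E) ;
  lagrangian_dom : ae_time T (fun s => forall y u (r : R), U u -> 0 < r <= 1 ->
    (L (s, (y, u)) < +oo)%E -> (L (s, (y, r *: u)) < +oo)%E) }.

(* In \bar R the convention 0 * +oo = 0 is in force, so that the inequality
   is trivial for l = 0 and l = 1. *)
Definition radially_convex T U L : Prop :=
  ae_time T (fun s => forall y u, U u ->
    forall r1 r2 l : R, 0 < r1 -> 0 < r2 -> 0 <= l <= 1 ->
      (L (s, (y, (l * r1 + (1 - l) * r2) *: u)) <=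
       l%:E * L (s, (y, r1 *: u)) + (1 - l)%:E * L (s, (y, r2 *: u)))%E).

(* Singleton of D_u L (s, y, u), or set0 if that derivative does not exist. *)
Definition radial_derivative L (p : spoint R n m) : set R :=
  [set q : R |
    (fun h : R =>
       (h^-1)%:E * (L (p.1, (p.2.1, (p.2.2 + h *: p.2.2)%R)) - L p))%E
    @ (0 : R)^' --> q%:E].

Definition radially_differentiable T U L : Prop :=
  ae_time T (fun s => forall y u, U u -> Dom T L (s, (y, u)) ->
    radial_derivative L (s, (y, u)) !=set0).

Definition radial_subdifferential L (p : spoint R n m) : set R :=
  [set q | forall r : R, 0 < r ->
    ((q * (r - 1))%:E <= L (p.1, (p.2.1, r *: p.2.2)) - L p)%E].

(* A selection picks an element of F p at the points p of Dom where F p is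
   nonempty. The subdifferential may be empty at a point (s, y, u) of Dom, even
   if r |-> L (s, y, r u) is convex: for instance 1 - sqrt (1 - r^2) on ]0, 1],
   extended by +oo, has no subgradient at r = 1. Moreover radially_convex and
   radially_differentiable say nothing for s in a null set. *)
Definition selection T L (F : spoint R n m -> set R) Q : Prop :=
  forall p, Dom T L p -> F p !=set0 -> F p (Q p).

Definition c_ T alpha d t B : R := (B + d * (T - t)) / (alpha * (T - t)).

Definition E_set T U L K nu : set (spoint R n m) :=
  [set p | [/\ Dom T L p, enorm p.2.1 <= K, U p.2.2 & nu <= enorm p.2.2]].

Definition F_set T U L K c rho : set (spoint R n m) :=
  [set p | [/\ Dom T L p, enorm p.2.1 <= K, U p.2.2, enorm p.2.2 < c &
               (rho%:E <= dist_to p (boundary_Dom T L))%E]].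

Definition growth_bounds T U L K nu c Q : Prop :=
  forall rho, 0 < rho ->
    (-oo < ereal_inf [set (L p - (Q p)%:E)%E | p in F_set T U L K c rho])%E /\
    (ereal_sup [set (L p - (Q p)%:E)%E | p in E_set T U L K nu] < +oo)%E.

Definition growth_condition T U alpha d L (B delta : R) : Prop :=
  forall K, 0 <= K -> exists nu c : R, [/\ 0 < nu, c_ T alpha d delta B < c &
    (radially_convex T U L /\
     exists2 Q, selection T L (radial_subdifferential L) Q &
                growth_bounds T U L K nu c Q)
    \/
    (radially_differentiable T U L /\
     exists2 Q, selection T L (radial_derivative L) Q &
                growth_bounds T U L K nu c Q)].

Definition bounded_well_inside T L : Prop :=
  forall S : set (spoint R n m), well_inside T L S ->
    bounded_set S ->
    exists M : R, forall p, S p -> (`|L p| <= M%:E)%E.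

Definition Dom_contains_small_controls T L : Prop :=
  forall K, 0 <= K -> exists2 r : R, 0 < r &
    forall s y u, 0 <= s <= T -> enorm y <= K -> enorm u <= r ->
      Dom T L (s, (y, u)).

Definition real_valued T L : Prop :=
  forall p, domain T p -> L p \is a fin_num.

Definition continuous_on_domain T L : Prop :=
  {within domain T, continuous L}.

End Lagrangian.

(* Main.v *)
(* Everything follows from the inequality L(ru) - L(u) >= q (r - 1) for a
   subgradient q at u. On E, comparing u with the point of its ray at a small
   fixed distance from 0, where L <= M by (a) and (b), bounds q from below and
   hence L - q from above. On F, comparing u with (1 + e) u, which stays
   well-inside Dom for a uniform small e since a segment leaving Dom meets the
   boundary, bounds q from above, and so L - q from below because L >= 0. *)
Require Import Defs.
From HB Require Import structures.
From mathcomp Require Import all_boot all_order all_algebra.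
From mathcomp Require Import all_classical all_reals all_analysis.
From mathcomp Require Import ring lra.
Import Order.TTheory GRing.Theory Num.Theory.
Import numFieldNormedType.Exports.
Local Open Scope classical_set_scope.
Local Open Scope ring_scope.

(** * Comparison of the Euclidean norm and distance with the sup norm *)

Section EuclideanNorm.
Context {R : realType}.

Lemma enorm_ge0 k (x : 'rV[R]_k) : 0 <= enorm x.
Proof. exact: sqrtr_ge0. Qed.

Lemma enormZ k (l : R) (x : 'rV[R]_k) : enorm (l *: x) = `|l| * enorm x.
Proof.
rewrite /enorm -sqrtr_sqr -sqrtrM ?sqr_ge0// mulr_sumr.
by congr Num.sqrt; apply: eq_bigr => i _; rewrite mxE exprMn.
Qed.

Lemma norm_le_enorm k (x : 'rV[R]_k) : `|x| <= enorm x.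
Proof.
rewrite [leLHS]/Num.norm/= mx_normrE; apply/bigmax_leP; split=> [|[i j] _ /=].
  exact: enorm_ge0.
rewrite ord1 -sqrtr_sqr ler_wsqrtr// (bigD1 j)//= lerDl.
by rewrite sumr_ge0// => l _; rewrite sqr_ge0.
Qed.

Lemma enorm_le_norm k (x : 'rV[R]_k) : enorm x <= k%:R * `|x|.
Proof.
have x_ge0 : 0 <= k%:R * `|x| by rewrite mulr_ge0.
rewrite -(ger0_norm x_ge0) -sqrtr_sqr ler_wsqrtr//.
have -> : (k%:R * `|x|) ^+ 2 = k%:R * (\sum_(i < k) `|x| ^+ 2).
  by rewrite sumr_const card_ord -mulr_natl; ring.
apply: (@le_trans _ _ (\sum_(i < k) `|x| ^+ 2)).
  apply: ler_sum => i _; rewrite -real_normK ?num_real// lerXn2r ?nnegrE//.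
  rewrite [leRHS]/Num.norm/= mx_normrE.
  by apply/bigmax_geP; right => /=; exists (ord0, i).
(* The remaining bound of the sum by [k] times itself uses [1 <= k]; for [k = 0] the sum is
   empty. *)
case: k x x_ge0 => [|k] x _; first by rewrite big_ord0 mulr0.
by rewrite ler_peMl ?ler1n// sumr_ge0// => i _; rewrite sqr_ge0.
Qed.

Lemma norm_spoint_le n m (p : spoint R n m) (e : R) :
  (`|p| <= e) = [&& `|p.1| <= e, `|p.2.1| <= e & `|p.2.2| <= e].
Proof. by rewrite !prod_normE !ge_max. Qed.

Lemma norm_le_edist n m (p q : spoint R n m) : `|p - q| <= Defs.edist p q.
Proof.
have le_sqrt (a b : R) : 0 <= a -> a ^+ 2 <= b -> a <= Num.sqrt b.
  by move=> a0 ab; rewrite -(ger0_norm a0) -sqrtr_sqr ler_wsqrtr.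
have sq0 (a : R) : 0 <= a ^+ 2 by rewrite sqr_ge0.
have := sq0 (p.1 - q.1); have := sq0 (enorm (p.2.1 - q.2.1)).
have := sq0 (enorm (p.2.2 - q.2.2)) => h1 h2 h3.
rewrite norm_spoint_le; apply/and3P; split=> /=.
- by apply: le_sqrt => //; rewrite real_normK ?num_real//=; lra.
- apply: (@le_trans _ _ (enorm (p.2.1 - q.2.1))); first exact: norm_le_enorm.
  by apply: le_sqrt; [exact: enorm_ge0|lra].
- apply: (@le_trans _ _ (enorm (p.2.2 - q.2.2))); first exact: norm_le_enorm.
  by apply: le_sqrt; [exact: enorm_ge0|lra].
Qed.

(** The three squared components contribute at most [1 + n ^ 2 + m ^ 2] times the squared sup norm,
    and this factor is at most [(1 + n + m) ^ 2]. *)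
Lemma edist_le_norm n m (p q : spoint R n m) :
  Defs.edist p q <= (1 + n + m)%:R * `|p - q|.
Proof.
have N0 : 0 <= `|p - q| by [].
have := lexx `|p - q|; rewrite {1}norm_spoint_le => /and3P[/= h1 h2 h3].
rewrite -[leRHS]ger0_norm ?mulr_ge0// -sqrtr_sqr ler_wsqrtr//.
have sq_le (a b : R) : 0 <= a -> a <= b -> a ^+ 2 <= b ^+ 2.
  by move=> a0 ab; rewrite lerXn2r ?nnegrE// (le_trans a0).
have k1 : (p.1 - q.1) ^+ 2 <= `|p - q| ^+ 2.
  by rewrite -real_normK ?num_real// sq_le.
have k2 : enorm (p.2.1 - q.2.1) ^+ 2 <= (n%:R * `|p - q|) ^+ 2.
  rewrite sq_le ?enorm_ge0//.
  apply: (@le_trans _ _ (n%:R * `|p.2.1 - q.2.1|)); first exact: enorm_le_norm.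
  by rewrite ler_wpM2l.
have k3 : enorm (p.2.2 - q.2.2) ^+ 2 <= (m%:R * `|p - q|) ^+ 2.
  rewrite sq_le ?enorm_ge0//.
  apply: (@le_trans _ _ (m%:R * `|p.2.2 - q.2.2|)); first exact: enorm_le_norm.
  by rewrite ler_wpM2l.
rewrite !natrD.
have n0 : 0 <= n%:R * `|p - q| by rewrite mulr_ge0.
have m0 : 0 <= m%:R * `|p - q| by rewrite mulr_ge0.
apply: le_trans (lerD (lerD k1 k2) k3) _.
rewrite !mulrDl mul1r; nra.
Qed.

End EuclideanNorm.

(** * Segments, and the distance to the boundary of the effective domain *)

Section Boundary.
Context {R : realType} {n m : nat}.
Implicit Types (T rho e : R) (L : spoint R n m -> \bar R) (p q : spoint R n m).

Lemma closure_norm (V : pseudoMetricNormedZmodType R) (A : set V) (x : V) (e : R) :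
  0 < e -> closure A x -> exists2 a, A a & `|x - a| < e.
Proof.
move=> e0 /(_ _ (nbhsx_ballx x e e0))[a [Aa]].
by rewrite -ball_normE/= => xa; exists a.
Qed.

(** Connectedness of [[a, b]]: if the path avoided the boundary, the times sent to the closure of
    [Dom T L] would be exactly those not sent to the closure of its complement. They would then form
    a nonempty relatively clopen set, hence all of [[a, b]], and [g b] would lie in both
    closures. *)
Lemma segment_meets_boundary T L (g : R -> spoint R n m) (a b : R) : a <= b ->
  continuous g -> (forall t, a <= t <= b -> domain T (g t)) ->
  Dom T L (g a) -> ~ Dom T L (g b) ->
  exists2 t, a <= t <= b & boundary_Dom T L (g t).
Proof.
move=> ab gc gT ga gb.
have closed_pre (D : set (spoint R n m)) : closed (g @^-1` closure D).
  by apply: preimage_closed; [move=> t _; exact: gc|exact: closed_closure].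
apply: contrapT => noB.
have gbC : closure (domain T `\` Dom T L) (g b).
  by apply: subset_closure; split=> //; apply: gT; rewrite ab lexx.
have : `[a, b] `&` g @^-1` closure (Dom T L) = `[a, b]%classic.
  apply: segment_connected.
  - exists a; split; first by rewrite /= in_itv/= lexx ab.
    exact: subset_closure.
  - exists (~` (g @^-1` closure (domain T `\` Dom T L))).
      by apply: closed_openC; exact: closed_pre.
    apply/seteqP; split=> t [tab gt]; split; try exact: tab.
      move=> gt'; apply: noB; exists t; first by move: tab; rewrite /= in_itv.
      split; last exact: gt'.
      by split; [apply: gT; move: tab; rewrite /= in_itv|exact: gt].
    apply: subset_closure; apply: contrapT => gtD; apply: gt.
    apply: subset_closure; split; last exact: gtD.
    by apply: gT; move: tab; rewrite /= in_itv.
  - exists (g @^-1` closure (Dom T L)); [exact: closed_pre|by []].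
move=> /seteqP[_ /(_ b)] []; first by rewrite /= in_itv/= lexx ab.
move=> _ gb'; apply: noB; exists b; first by rewrite ab lexx.
split; last exact: gbC.
by split; [apply: gT; rewrite ab lexx|exact: gb'].
Qed.

Lemma le_dist_to p (A : set (spoint R n m)) (e : R) :
  (e%:E <= dist_to p A)%E <-> forall q, A q -> e <= Defs.edist p q.
Proof.
split=> [ep q Aq|ep].
  by rewrite -lee_fin (le_trans ep)//; apply: ereal_inf_lbound; exists q.
by apply: le_ereal_inf_tmp => _ [q Aq <-]; rewrite lee_fin ep.
Qed.

(** If [v] left the effective domain, the segment from [u] to [v] would meet the boundary at
    distance less than [rho]. The new margin is the triangle inequality in the sup norm; passing to
    that norm divides [rho] by [1 + n + m], and passing back costs nothing. *)
Lemma near_control_Dom T L s y (u v : 'rV[R]_m) rho :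
  Dom T L (s, (y, u)) ->
  (rho%:E <= dist_to (s, (y, u)) (boundary_Dom T L))%E ->
  (1 + n + m)%:R * `|u - v| < rho ->
  Dom T L (s, (y, v)) /\
  ((rho / (1 + n + m)%:R - `|u - v|)%:E <=
     dist_to (s, (y, v)) (boundary_Dom T L))%E.
Proof.
move=> Du /le_dist_to du uv.
have N0 : 0 < (1 + n + m)%:R :> R by rewrite ltr0n.
(* Only the control moves, so the segment stays in [domain T]. *)
pose g (t : R) : spoint R n m := (s, (y, u + t *: (v - u))).
have normg a b : `|g a - g b| = `|a - b| * `|u - v|.
  rewrite prod_normE/= prod_normE/= !subrr !normr0 opprD addrACA subrr add0r.
  by rewrite -scalerBl normrZ [`|v - u|]distrC !max_r// mulr_ge0.
have g0 : g 0 = (s, (y, u)) by rewrite /g scale0r addr0.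
have g1 : g 1 = (s, (y, v)) by rewrite /g scale1r addrC subrK.
split.
  apply: contrapT => Dv.
  have gc : continuous g.
    move=> t; apply/cvgrPdist_le => e e0; near=> r.
    rewrite normg (@le_trans _ _ (e / (`|u - v| + 1) * `|u - v|))//.
      rewrite ler_wpM2r//; near: r.
      move: (@cvg_id _ (nbhs t)) => /cvgrPdist_le; apply.
      by rewrite divr_gt0 ?ltr_wpDl.
    by rewrite mulrAC ler_pdivrMr ?ltr_wpDl// ler_pM2l// lerDl.
  have [|||t /andP[t0 t1] /du] := segment_meets_boundary T L g 0 1 ler01 gc.
  - by move=> t _; case: Du.
  - by rewrite g0.
  - by rewrite g1.
  rewrite leNgt => /negP; apply; apply: le_lt_trans uv.
  apply: le_trans (edist_le_norm _ _ _ _) _; rewrite -g0 normg ler_wpM2l//.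
  by rewrite sub0r normrN ger0_norm// ler_piMl.
apply/le_dist_to => q /du qu; apply: le_trans (norm_le_edist _ _ _ _).
have : rho / (1 + n + m)%:R <= `|(s, (y, u)) - q|.
  by rewrite ler_pdivrMr// mulrC (le_trans qu)// edist_le_norm.
have := ler_distD (s, (y, v)) (s, (y, u)) q.
have := normg 0 1; rewrite g0 g1 sub0r normrN normr1 mul1r => ->; lra.
Unshelve. all: by end_near.
Qed.

End Boundary.

Lemma bounded_set_norm (R : realType) (V : normedModType R) (S : set V) (M : R) :
  (forall x, S x -> `|x| <= M) -> bounded_set S.
Proof.
move=> SM; exists M; split=> [|e Me x /SM]; first exact: num_real.
by move/le_trans; apply; exact: ltW.
Qed.

(** * Bounds on the Lagrangian and on its radial subgradients *)

Section GrowthBounds.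
Context {R : realType} {n m : nat}.
Implicit Types (T K rho c q : R) (L : spoint R n m -> \bar R).
Implicit Types (p : spoint R n m) (Q : spoint R n m -> R) (U : set 'rV[R]_m).

Lemma norm_spoint_bound T K c p :
  domain T p -> enorm p.2.1 <= K -> enorm p.2.2 <= c ->
  `|p| <= Num.max T (Num.max K c).
Proof.
move=> /andP[p0 pT] pK pc; rewrite norm_spoint_le ger0_norm//; apply/and3P; split.
- by rewrite le_max pT.
- have py : `|p.2.1| <= enorm p.2.1 by exact: norm_le_enorm.
  by rewrite !le_max (le_trans py pK) orbT.
- have pu : `|p.2.2| <= enorm p.2.2 by exact: norm_le_enorm.
  by rewrite !le_max (le_trans pu pc) !orbT.
Qed.

Lemma Dom_fin_num T L p : (forall p, domain T p -> (0 <= L p)%E) ->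
  Dom T L p -> exists2 a, L p = a%:E & 0 <= a.
Proof.
move=> L0 [Tp]; move: (L0 _ Tp); case: (L p) => [a| |]//.
by rewrite lee_fin => a0 _; exists a.
Qed.

(** To get a bound from (a), the small controls must form a well-inside set. So (b) is applied to a
    larger ball of states and [r] is taken smaller than the radius it yields, which leaves a uniform
    margin. *)
Lemma bounded_small_controls T L K : 0 <= K ->
  bounded_well_inside T L -> Dom_contains_small_controls T L ->
  exists r M : R, 0 < r /\ forall s y u, 0 <= s <= T -> enorm y <= K ->
    enorm u <= r -> Dom T L (s, (y, u)) /\ (L (s, (y, u)) <= M%:E)%E.
Proof.
move=> K0 Lb LD.
(* A state within sup distance 1 of the [K]-ball has sup norm at most [K + 1], hence Euclidean norm
   at most [n * (K + 1)]. *)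
have [|r' r'0 small] := LD (n%:R * (K + 1)).
  by rewrite mulr_ge0// addr_ge0.
(* A control within [r] of the [r]-ball has Euclidean norm at most [m * (2 * r) <= r']; the
   successor of [m] keeps the denominator positive. *)
have m0 : 0 < 2 * m.+1%:R :> R by rewrite mulr_gt0// ltr0n.
pose r := r' / (2 * m.+1%:R).
have r0 : 0 < r by rewrite divr_gt0.
have mr : m.+1%:R * (2 * r) = r'.
  by rewrite mulrA (mulrC _ 2) [LHS]mulrC /r divfK// gt_eqF.
have inDom s y u (v : spoint R n m) : domain T v -> enorm y <= K -> enorm u <= r ->
    `|(s, (y, u)) - v| <= Num.min 1 r -> Dom T L v.
  move: v => [s' [y' u']] Tv yK ur; rewrite norm_spoint_le/= => /and3P[_ yy' uu'].
  apply: small => //.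
    apply: (@le_trans _ _ (n%:R * `|y'|)); first exact: enorm_le_norm.
    rewrite ler_wpM2l//.
    have := ler_distD y y' 0; rewrite !subr0 distrC.
    have : `|y| <= enorm y by exact: norm_le_enorm.
    by move: yy'; rewrite le_min => /andP[]; lra.
  apply: (@le_trans _ _ (m%:R * `|u'|)); first exact: enorm_le_norm.
  rewrite -mr ler_pM ?ler_nat//.
  have := ler_distD u u' 0; rewrite !subr0 distrC.
  have : `|u| <= enorm u by exact: norm_le_enorm.
  by move: uu'; rewrite le_min => /andP[]; lra.
(* Half the margin: a boundary point within [e] of [S] would have a point outside [Dom T L] within
   [e] of it, thus within [Num.min 1 r] of [S], against [inDom]. *)
pose e : R := Num.min 1 r / 2.
have e0 : 0 < e by rewrite divr_gt0// lt_min ltr01 r0.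
pose S : set (spoint R n m) :=
  [set p | [/\ domain T p, enorm p.2.1 <= K & enorm p.2.2 <= r]].
have SD p : S p -> Dom T L p.
  move=> [Tp pK pr]; move: p Tp pK pr => [s [y u]] /= Tp pK pr.
  by apply: (inDom s y u) => //; rewrite subrr normr0 ltW// lt_min ltr01 r0.
have [||M SM] := Lb S.
- split=> //; exists e => // -[s [y u]] [/= Tp pK pr].
  apply/le_dist_to => v [_ /(closure_norm _ _ _ e e0)[w [Tw Dw] vw]].
  rewrite leNgt; apply/negP => pv; apply: Dw; apply: (inDom s y u) => //.
  have := ler_distD v (s, (y, u)) w.
  have := le_lt_trans (norm_le_edist _ _ _ _) pv.
  by move: vw; rewrite /e; lra.
- apply: (@bounded_set_norm _ _ _ (Num.max T (Num.max K r))) => p [].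
  exact: norm_spoint_bound.
exists r, M; split=> // s y u sT yK ur.
have Sp : S (s, (y, u)) by [].
split; first exact: SD.
exact: le_trans (lee_abs _) (SM _ Sp).
Qed.

Lemma bounded_F_set T U L K c rho : 0 < rho -> bounded_well_inside T L ->
  exists M : R, forall p, F_set T U L K c rho p -> (L p <= M%:E)%E.
Proof.
move=> rho0 Lb; have [||M SM] := Lb (F_set T U L K c rho).
- by split=> [p []//|]; exists rho => // p [].
- apply: (@bounded_set_norm _ _ _ (Num.max T (Num.max K c))) => p [] [Tp _] pK _ pc _.
  by apply: norm_spoint_bound => //; exact: ltW.
by exists M => p /SM; apply: le_trans (lee_abs _).
Qed.

(** Shrinking [u] to norm [r] by the factor [l] gives [L(u) - q (1 - l) <= L(l u) <= M], from which
    the gap is bounded by [2 * M]. *)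
Lemma subgradient_gap_le T U L K : 0 <= K ->
  (forall p, domain T p -> (0 <= L p)%E) ->
  bounded_well_inside T L -> Dom_contains_small_controls T L ->
  exists nu M : R, 0 < nu /\ forall p q, E_set T U L K nu p ->
    radial_subdifferential L p q -> (L p - q%:E <= M%:E)%E.
Proof.
move=> K0 L0 Lb LD; have [r [M [r0 rM]]] := bounded_small_controls _ _ _ K0 Lb LD.
(* The threshold [2 * r] forces [l <= 1 / 2], so that for negative [q] the leftover term [- q * l]
   is at most [- q * (1 - l) <= M]. *)
exists (2 * r), (2 * M); split=> [|p q]; first by rewrite mulr_gt0.
move: p => [s [y u]] [/= Dp yK Uu nu_u] pq.
have u0 : 0 < enorm u by apply: lt_le_trans nu_u; rewrite mulr_gt0.
pose l := r / enorm u.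
have l0 : 0 < l by rewrite divr_gt0.
have l2 : l <= 1 / 2 by rewrite ler_pdivrMr//; lra.
have [|/= Dv Lv] := rM s y (l *: u) Dp.1 yK.
  by rewrite enormZ gtr0_norm// divfK// gt_eqF.
have [b Lvb b0] := Dom_fin_num _ _ _ L0 Dv.
have [a Lpa a0] := Dom_fin_num _ _ _ L0 Dp.
move: (pq l l0) Lv; rewrite /= Lvb Lpa -!EFinB !lee_fin => qb bM.
have [q0|q0] := leP 0 q; first by nra.
have : - q * (1 - l) <= M by lra.
nra.
Qed.

(** Stretching [u] by [1 + e] gives [q * e <= L((1 + e) u) - L(u) <= M], hence [q <= M / e]. *)
Lemma subgradient_gap_ge T U L K c rho : 0 < c -> 0 < rho -> cone U ->
  (forall p, domain T p -> (0 <= L p)%E) -> bounded_well_inside T L ->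
  exists M : R, forall p q, F_set T U L K c rho p ->
    radial_subdifferential L p q -> (M%:E <= L p - q%:E)%E.
Proof.
move=> c0 rho0 coneU L0 Lb.
have N0 : 0 < (1 + n + m)%:R :> R by rewrite ltr0n.
(* Chosen so that [e * c = rho']: the stretch moves [u] by at most half of the sup-norm margin, and
   the other half, [rho'], remains. *)
pose e := rho / (1 + n + m)%:R / (2 * c).
pose rho' := rho / (1 + n + m)%:R / 2.
have rho'0 : 0 < rho' by rewrite !divr_gt0.
have e0 : 0 < e by rewrite !divr_gt0// mulr_gt0.
have [M FM] := bounded_F_set T U L K ((1 + e) * c) rho' rho'0 Lb.
have e1 : 0 < 1 + e by rewrite addr_gt0.
exists (- (M / e)) => -[s [y u]] q [/= Dp yK Uu uc dp] pq.
have uv : `|u - (1 + e) *: u| <= rho'.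
  rewrite scalerDl scale1r opprD addrA subrr sub0r normrN normrZ gtr0_norm//.
  have -> : rho' = e * c by rewrite /rho' /e; field; rewrite !gt_eqF.
  rewrite ler_wpM2l//; first exact: ltW.
  by rewrite ltW// (le_lt_trans _ uc)//; exact: norm_le_enorm.
have rhoN : (1 + n + m)%:R * rho' = rho / 2.
  by rewrite /rho'; field; rewrite gt_eqF.
have [|Dv dv] := near_control_Dom _ _ _ _ _ ((1 + e) *: u) _ Dp dp.
  apply: (@le_lt_trans _ _ ((1 + n + m)%:R * rho')); first by rewrite ler_wpM2l.
  by rewrite rhoN; lra.
have /FM Lv : F_set T U L K ((1 + e) * c) rho' (s, (y, (1 + e) *: u)).
  split=> //=; first exact: coneU.
    by rewrite enormZ gtr0_norm// ltr_pM2l.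
  by apply: le_trans dv; rewrite lee_fin; move: uv; rewrite /rho'; lra.
have [b Lvb b0] := Dom_fin_num _ _ _ L0 Dv.
have [a Lpa a0] := Dom_fin_num _ _ _ L0 Dp.
move: (pq (1 + e) e1) Lv; rewrite /= Lvb Lpa -!EFinB !lee_fin => qb bM.
suff : q <= M / e by lra.
by rewrite ler_pdivlMr//; lra.
Qed.

End GrowthBounds.

(** * The growth condition from (a) and (b) *)

Lemma growth_condition_of_well_inside (R : realType) (n m : nat)
    (T alpha d B delta : R) (U : set 'rV[R]_m) (L : spoint R n m -> \bar R) :
  0 < alpha -> 0 <= d -> 0 <= B -> delta < T -> cone U ->
  (forall p, domain T p -> (0 <= L p)%E) -> radially_convex T U L ->
  bounded_well_inside T L -> Dom_contains_small_controls T L ->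
  growth_condition T U alpha d L B delta.
Proof.
move=> alpha0 d0 B0 deltaT coneU L0 Lconv Lb LD K K0.
have [nu [M1 [nu0 le_gap]]] := subgradient_gap_le T U L K K0 L0 Lb LD.
have c0 : 0 <= c_ T alpha d delta B.
  have Td : 0 < T - delta by rewrite subr_gt0.
  by rewrite divr_ge0 ?addr_ge0 ?mulr_ge0// ltW.
(* The lower bound on the gap is available for every positive [c], so any value above
   [c_ T alpha d delta B] serves. *)
exists nu, (c_ T alpha d delta B + 1); split=> //; first by rewrite ltrDl.
left; split=> //.
(* Where the subdifferential is empty the selection is unconstrained, and
   [Q := L] makes [L - Q] vanish. *)
pose Q p := if pselect (radial_subdifferential L p !=set0) is left h
  then projT1 (cid h) else fine (L p).
have QP p : Dom T L p ->
    radial_subdifferential L p (Q p) \/ (L p - (Q p)%:E)%E = 0%E.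
  move=> /(Dom_fin_num _ _ _ L0)[a La _]; rewrite /Q; case: pselect => [h|_].
    by left; exact: (projT2 (cid h)).
  by right; rewrite La /= subee.
exists Q.
  by move=> p _ p0; rewrite /Q; case: pselect => // h; exact: (projT2 (cid h)).
move=> rho rho0; split.
  have [|M2 ge_gap] := subgradient_gap_ge T U L K (c_ T alpha d delta B + 1)
      rho _ rho0 coneU L0 Lb.
    by rewrite ltr_wpDl.
  (* The minimum with 0 covers the points with empty subdifferential, where the gap is 0. *)
  apply: (@lt_le_trans _ _ (Num.min M2 0)%:E); first exact: ltNyr.
  apply: le_ereal_inf_tmp => _ [p Fp <-].
  have [Dp _ _ _ _] := Fp; have [/(ge_gap _ _ Fp)|->] := QP _ Dp.
    by apply: le_trans; rewrite lee_fin ge_min lexx.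
  by rewrite lee_fin ge_min lexx orbT.
apply: (@le_lt_trans _ _ (Num.max M1 0)%:E); last exact: ltry.
apply: ge_ereal_sup => _ [p Ep <-].
have [Dp _ _ _] := Ep; have [/(le_gap _ _ Ep)|->] := QP _ Dp.
  by move/le_trans; apply; rewrite lee_fin le_max lexx.
by rewrite lee_fin le_max lexx orbT.
Qed.

(** * The continuous real-valued case, by compactness *)

Lemma compact_norm_ball (R : realType) (k : nat) (M : R) :
  compact [set x : 'rV[R]_k | `|x| <= M].
Proof.
apply: bounded_closed_compact; first exact: (@bounded_set_norm _ _ _ M).
apply: (@preimage_closed _ _ (fun x : 'rV[R]_k => `|x|) [set x | x <= M]).
  by move=> x _; exact: norm_continuous.
exact: closed_le.
Qed.

Lemma continuous_bounded_well_inside (R : realType) (n m : nat) (T : R)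
    (L : spoint R n m -> \bar R) :
  real_valued T L -> continuous_on_domain T L -> bounded_well_inside T L.
Proof.
move=> Lfin Lcont S [SD _] [M0 [_ /(_ (M0 + 1))]]; rewrite ltrDl ltr01.
move=> /(_ isT) SM.
(* A compact box inside [domain T] that contains [S]; the continuous image of [A] under [L] is
   bounded. *)
pose A : set (spoint R n m) := `[0, T]%classic `*`
  ([set y | `|y| <= M0 + 1] `*` [set u | `|u| <= M0 + 1]).
have AT p : A p -> domain T p by case; rewrite /= in_itv.
have cA : compact (fine @` (L @` A)).
  apply: continuous_compact.
    apply: continuous_in_subspaceT => x /set_mem[p /AT Tp <-].
    rewrite -(fineK (Lfin _ Tp)); apply: fine_fcvg; exact: cvg_id.
  apply: continuous_compact; last first.
    apply: compact_setX; first exact: segment_compact.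
    by apply: compact_setX; exact: compact_norm_ball.
  exact: continuous_subspaceW Lcont.
have [M1 [_ /(_ (M1 + 1))]] := compact_bounded cA; rewrite ltrDl ltr01.
move=> /(_ isT) AM; exists (M1 + 1) => p Sp.
have Tp : domain T p by case: (SD _ Sp).
rewrite -(fineK (Lfin _ Tp)) lee_fin; apply: AM.
exists (L p) => //; exists p => //.
have /= := SM _ Sp; rewrite norm_spoint_le => /and3P[_ ? ?].
by split=> //=; rewrite in_itv.
Qed.

Theorem proposition4p24 (R : realType) (n m : nat) (T alpha d : R)
    (U : set 'rV[R]_m) (L : spoint R n m -> \bar R)
    (n_ge1 : (1 <= n)%N) (m_ge1 : (1 <= m)%N)
    (T_gt0 : 0 < T) (alpha_gt0 : 0 < alpha) (d_ge0 : 0 <= d)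
    (U_neq0 : U !=set0) (U_cone : cone U)
    (L_lagrangian : is_lagrangian T U alpha d L)
    (L_convex : radially_convex T U L) :
  (bounded_well_inside T L -> Dom_contains_small_controls T L ->
     forall B delta : R, 0 <= B -> 0 <= delta < T ->
       growth_condition T U alpha d L B delta) /\
  (real_valued T L -> continuous_on_domain T L ->
     forall B delta : R, 0 <= B -> 0 <= delta < T ->
       growth_condition T U alpha d L B delta).
Proof.
have L0 : forall p, domain T p -> (0 <= L p)%E by case: L_lagrangian.
split=> [Lb LD|Lfin Lcont] B delta B0 /andP[_ deltaT].
  exact: growth_condition_of_well_inside.
apply: growth_condition_of_well_inside => //.
  exact: continuous_bounded_well_inside.
(* For real-valued [L] the effective domain is all of [domain T], so any radius would do. *)
move=> K _; exists 1 => // s y u sT _ _; split=> //.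
by rewrite ltey_eq Lfin.
Qed.
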